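(* Let $m$ be a positive even integer, $k,i$ positive integers, $u$ an integer, $Q=2^{m}+1$, $K=2^{k}$, and for $1\le j\le K$ let $d_{j}=(K-1)i+uQ+(Q-2)(j-1)i$. Assume $v_{2}(k) \leq v_{2}(m)$, $\gcd(i,Q)=1$ and $\gcd(d_{1},2^{2m}-1)=1$. Then the polynomial $$\sum_{1\le j\le K,\ j \equiv 0,1 \ (\mathrm{mod}\ 3)}x^{d_{j}}$$ is a permutation polynomial over $\mathbb{F}_{2^{2m}}$ provided one of the following holds: (i) $k$ is even; or (ii) $k$ is odd and $\gcd(K+1,Q)=1$.
   Context: $v_2(\cdot)$ denotes the 2-adic valuation. A polynomial $f$ is a permutation polynomial over $\mathbb{F}_{q}$ if $x\mapsto f(x)$ is a bijection of $\mathbb{F}_q$. Integer exponents are understood modulo $2^{2m}-1=Q(Q-2)$, i.e. $x^{d}$ means $x^{d \bmod (2^{2m}-1)}$. *)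

(* Defs.v *)
From HB Require Import structures.
From mathcomp Require Import all_boot all_order all_algebra.

Set Implicit Arguments.
Unset Strict Implicit.
Unset Printing Implicit Defensive.

Import Order.TTheory GRing.Theory Num.Theory.
Local Open Scope ring_scope.

Definition perm_poly (F : finFieldType) (f : {poly F}) : Prop :=
  bijective (fun x : F => f.[x]).

Definition Qm (m : nat) : nat := (2 ^ m + 1)%N.

Definition dexp (m k i : nat) (u : int) (j : nat) : int :=
  ((2 ^ k)%N%:Z - 1) * i%:Z + u * (Qm m)%:Z
  + ((Qm m)%:Z - 2) * (j%:Z - 1) * i%:Z.

(* [modz] by the positive integer [2 ^ (2 * m) - 1] gives the least nonnegative
   residue, including for negative [d], so [absz] only changes the type. *)
Definition rexp (m : nat) (d : int) : nat :=
  `|(d %% ((2 ^ (2 * m))%N%:Z - 1))%Z|%N.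

Definition dpoly (F : finFieldType) (m k i : nat) (u : int) : {poly F} :=
  \sum_(1 <= j < (2 ^ k).+1 | (j == 0 %[mod 3]) || (j == 1 %[mod 3]))
     'X^(rexp m (dexp m k i u j)).

(* Main.v *)
Require Import Defs.
From HB Require Import structures.
From mathcomp Require Import all_boot all_order all_algebra.
From mathcomp Require Import all_fingroup all_solvable all_field.
From mathcomp Require Import ring zify.

Import Order.TTheory GRing.Theory Num.Theory.
Local Open Scope ring_scope.

(** Put [q = 2 ^ m], [K = 2 ^ k] and [z = x ^ ((q - 1) * i)], so [z ^ (q + 1) = 1]
    and [f x = x ^ d_1 * h z] with [h] a sum of powers of [z]. Multiplying [h] by
    [1 + z + z ^ 2] telescopes it, and Frobenius then gives
    [f x ^ (q - 1) = z ^ (K - 1) * h z ^ (q - 1) = num z / den z] with trinomials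
    [num], [den] of degree at most [K + 1]. Let [w] be a primitive cube root of
    unity, [a = z + w + 1], [b = z + w]. The quotient of [num + w * den] by
    [num + w ^ 2 * den] is, up to a constant, [(a / b) ^ (K - 1)] or its inverse,
    and [(a / b) ^ (q + 1) = w]. As [K - 1] and [q + 1] are coprime (this is
    [v_2 k <= v_2 m]), the value [f x] determines [z], hence [x ^ d_1], hence [x]. *)

(** * Telescoping the sum of powers in characteristic 2 *)

Definition gap_sum {R : pzRingType} (n : nat) (z : R) : R :=
  \sum_(1 <= j < n.+1 | (j == 0 %[mod 3]) || (j == 1 %[mod 3])) z ^+ j.-1.

(* With [Z = z ^+ K], these are the denominator and the numerator of
   [z ^+ K.-1 * h z ^+ (q - 1)], where [h = gap_sum K]; [b] is the parity of
   [k]. *)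
Definition den {R : pzRingType} (b : bool) (z Z : R) : R :=
  1 + z + (if b then 1 else z) * Z.

Definition num {R : pzRingType} (b : bool) (z Z : R) : R :=
  z * Z + Z + (if b then z else 1).

(** [ring] does not know that [2 = 0]; the witness [e] supplies the even discrepancy, so that
    [x = y + 2 * e] is left for [ring]. *)
Lemma eq_mod2 (R : comNzRingType) (e x y : R) :
  2 = 0 :> R -> x = y + 2 * e -> x = y.
Proof. by move=> h2 ->; rewrite h2 mul0r addr0. Qed.

Lemma gap_sumS (R : pzRingType) (z : R) (n : nat) :
  gap_sum n.+1 z = gap_sum n z +
    (if (n.+1 == 0 %[mod 3]) || (n.+1 == 1 %[mod 3]) then z ^+ n else 0).
Proof. by rewrite /gap_sum big_mkcond big_nat_recr //= -big_mkcond. Qed.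

(** Modulo 2, [(1 + z) * (1 + z + z ^+ 2) = 1 + z ^+ 3], so each new pair of powers only shifts the
    closing term by three. *)
Lemma gap_sum_mod1 (R : comNzRingType) (z : R) (n : nat) : 2 = 0 :> R ->
  (1 + z + z ^+ 2) * gap_sum (3 * n).+1 z = 1 + z + z ^+ (3 * n).+2.
Proof.
move=> h2; elim: n => [|n IHn].
  by rewrite /gap_sum muln0 big_mkcond big_nat1 /= expr0 mulr1.
have c0 : ((3 * n.+1)%N == 0 %[mod 3]) || ((3 * n.+1)%N == 1 %[mod 3]) by lia.
have c1 : ((3 * n.+1).+1 == 0 %[mod 3]) || ((3 * n.+1).+1 == 1 %[mod 3]) by lia.
have c2 : ((3 * n).+2 == 0 %[mod 3]) || ((3 * n).+2 == 1 %[mod 3]) = false by lia.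
rewrite gap_sumS c1 (_ : (3 * n.+1)%N = (3 * n).+3) in c0 *; last by lia.
rewrite 2!gap_sumS c0 c2 addr0 2!mulrDr IHn.
rewrite !exprSr; set Z := z ^+ (3 * n).
apply: (eq_mod2 _ (Z * z ^+ 2 + Z * z ^+ 3 + Z * z ^+ 4)) => //.
by ring.
Qed.

Lemma gap_sum_mod2 (R : comNzRingType) (z : R) (n : nat) :
  gap_sum (3 * n).+2 z = gap_sum (3 * n).+1 z.
Proof.
have c2 : ((3 * n).+2 == 0 %[mod 3]) || ((3 * n).+2 == 1 %[mod 3]) = false by lia.
by rewrite gap_sumS c2 addr0.
Qed.

Lemma expn2_mod3 (k : nat) : (2 ^ k = (if odd k then 2 else 1) %[mod 3])%N.
Proof. by elim: k => // k; rewrite expnS /=; case: (odd k) => /=; lia. Qed.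

(** For odd [k] the index [2 ^ k] is 2 mod 3 and is skipped, so the closing term is [z ^+ (2 ^ k)]
    instead of [z ^+ (2 ^ k).+1]. *)
Lemma gap_sum_expn2 (R : comNzRingType) (z : R) (k : nat) : 2 = 0 :> R ->
  (1 + z + z ^+ 2) * gap_sum (2 ^ k) z = den (odd k) z (z ^+ (2 ^ k)).
Proof.
move=> h2; have := expn2_mod3 k; rewrite /den; case: (odd k) => hk.
  have -> : (2 ^ k = (3 * (2 ^ k %/ 3)).+2)%N by lia.
  by rewrite gap_sum_mod2 gap_sum_mod1 // mul1r.
have -> : (2 ^ k = (3 * (2 ^ k %/ 3)).+1)%N by lia.
by rewrite gap_sum_mod1 // -exprS.
Qed.

(** * Frobenius, cube roots of unity and the circle [z ^ (q + 1) = 1] *)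

Section Char2.

Context (F : fieldType) (h2 : 2 = 0 :> F).

Lemma pnat_expn2 (n : nat) : [pchar F].-nat (2 ^ n)%N.
Proof.
by rewrite pnatX pnatE // inE /= h2 eqxx.
Qed.

Lemma frobD (n : nat) (x y : F) :
  (x + y) ^+ (2 ^ n) = x ^+ (2 ^ n) + y ^+ (2 ^ n).
Proof. exact/exprDn_pchar/pnat_expn2. Qed.

Lemma sqr_eq1 (r : F) : r ^+ 2 = 1 -> r = 1.
Proof.
move=> hr; have /eqP : (r - 1) ^+ 2 = 0.
  by apply: (eq_mod2 _ (1 - r)) => //; rewrite sqrrB hr; ring.
by rewrite expf_eq0 /= subr_eq0 => /eqP.
Qed.

(* [r ^ (2 ^ m) = r^-1] while [r ^ (2 ^ k) = r]; a common multiple of [m] and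
   [k] that is an odd multiple of [m] then gives [r = r^-1]. *)
Lemma expn2_roots_eq1 (m k : nat) (r : F) : (0 < m)%N -> (0 < k)%N ->
  (logn 2 k <= logn 2 m)%N ->
  r ^+ (2 ^ k).-1 = 1 -> r ^+ (2 ^ m).+1 = 1 -> r = 1.
Proof.
move=> hm hk hv rk rm.
have r0 : r != 0 by apply/eqP => r0; move/eqP: rm; rewrite r0 expr0n eq_sym oner_eq0.
have rm' : r ^+ (2 ^ m) = r^-1.
  by apply: (mulfI r0); rewrite -exprS rm mulfV.
have rk' : r ^+ (2 ^ k) = r.
  by rewrite -[(2 ^ k)%N]prednK ?expn_gt0 // exprS rk mulr1.
have it_k n : r ^+ (2 ^ (k * n)) = r.
  by elim: n => [|n IHn]; rewrite ?muln0 // mulnS expnD exprM rk'.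
have it_m n : r ^+ (2 ^ (m * n)) = if odd n then r^-1 else r.
  elim: n => [|n IHn]; rewrite ?muln0 // mulnS expnD exprM rm' exprVn IHn /=.
  by case: (odd n); rewrite ?invrK.
have [k' hk' ek] := pfactor_coprime (isT : prime 2) hk.
have dm : (2 ^ logn 2 k %| m)%N by rewrite pfactor_dvdn.
have hc : (m * k' = k * (m %/ 2 ^ logn 2 k))%N.
  by rewrite {1}ek -mulnA [(2 ^ _ * _)%N]mulnC divnK // mulnC.
have := it_m k'; rewrite -coprime2n hk' hc it_k => er.
by apply: sqr_eq1; rewrite expr2 {2}er mulfV.
Qed.

Context (w : F) (hw : w ^+ 2 = w + 1).

Lemma w_neq0 : w != 0.
Proof.
by apply/eqP => w0; move/eqP: hw; rewrite w0 expr0n /= add0r eq_sym oner_eq0.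
Qed.

Lemma expn2_w (k : nat) : w ^+ (2 ^ k) = if odd k then w + 1 else w.
Proof.
elim: k => [|k IHk]; first by rewrite expr1.
rewrite expnSr exprM IHk /=; case: (odd k) => //=.
by apply: (eq_mod2 _ (w + 1)) => //; ring: hw.
Qed.

Lemma addw_neq0 (z : F) : z ^+ 2 + z + 1 != 0 ->
  z + w != 0 /\ z + w + 1 != 0.
Proof.
have -> : z ^+ 2 + z + 1 = (z + w) * (z + w + 1).
  apply: (eq_mod2 _ (- z * w - w)) => //; ring: hw.
by rewrite mulf_eq0 => /norP.
Qed.

(* Moebius change of variable over [F_4]: the combinations [num + w * den] and
   [num + w ^+ 2 * den] are monomials in [z + w] and [z + w + 1]. *)
Lemma num_den_factor (k : nat) (z : F) :
  let Z := z ^+ (2 ^ k) in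
  let A := (z + w + 1) ^+ (2 ^ k) in
  let B := (z + w) ^+ (2 ^ k) in
  if odd k then
    (num true z Z + w * den true z Z = B * (z + w + 1)) /\
    (num true z Z + w ^+ 2 * den true z Z = A * (z + w))
  else
    (num false z Z + w * den false z Z = w ^+ 2 * (A * (z + w))) /\
    (num false z Z + w ^+ 2 * den false z Z = w * (B * (z + w + 1))).
Proof.
move=> Z A B; rewrite /A /B !frobD expn2_w expr1n -/Z /num /den.
case: (odd k); split.
- apply: (eq_mod2 _ (- w - 1)) => //; ring: hw.
- apply: (eq_mod2 _ (Z - w)) => //; ring: hw.
- apply: (eq_mod2 _ (- w * Z - (w + 1) * z - 2 * w - 1)) => //; ring: hw.
- apply: (eq_mod2 _ (z * Z - w * Z - w)) => //; ring: hw.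
Qed.

Lemma unit_circle_neq0 (m : nat) (z : F) : z ^+ (2 ^ m).+1 = 1 -> z != 0.
Proof.
move=> hz; apply/eqP => z0; move/eqP: hz.
by rewrite z0 expr0n eq_sym oner_eq0.
Qed.

(** For even [m], [2 ^ m + 1] is 2 mod 3; a root has [z ^+ 3 = 1], hence [z ^+ 2 = 1] and [z = 1],
    which is not a root. *)
Lemma unit_circle_not_cube (m : nat) (z : F) : ~~ odd m ->
  z ^+ (2 ^ m).+1 = 1 -> z ^+ 2 + z + 1 != 0.
Proof.
move=> hm hz; apply/eqP => h0.
have z3 : z ^+ 3 = 1.
  by apply/eqP; rewrite -subr_eq0 -(mulr0 (z - 1)) -h0; apply/eqP; ring.
have z1 : z = 1.
  apply: sqr_eq1; have := expn2_mod3 m; rewrite (negPf hm) => hmod.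
  have e : ((2 ^ m).+1 = 3 * (2 ^ m %/ 3) + 2)%N by lia.
  by rewrite e exprD exprM z3 expr1n mul1r in hz.
by move/eqP: h0; rewrite z1 expr1n -[1 + 1]/(2%:R : F) h2 add0r oner_eq0.
Qed.

(** On the circle Frobenius inverts [z] and [Z], so [num] is the reciprocal trinomial of [den]. *)
Lemma den_frob (m k : nat) (z : F) (Z := z ^+ (2 ^ k)) :
  z ^+ (2 ^ m).+1 = 1 ->
  z * Z * den (odd k) z Z ^+ (2 ^ m) = num (odd k) z Z.
Proof.
move=> hz; have hzq : z * z ^+ (2 ^ m) = 1 by rewrite -exprS.
have hZq : Z * Z ^+ (2 ^ m) = 1.
  by rewrite -exprS /Z -!exprM mulnC exprM hz expr1n.
rewrite /den /num !frobD expr1n exprMn; case: (odd k); rewrite ?expr1n.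
  by ring: hzq hZq.
by ring: hzq hZq.
Qed.

Lemma gap_sum_frob (m k : nat) (z : F) :
  z ^+ (2 ^ m).+1 = 1 ->
  (1 + z + z ^+ 2) * (z ^+ (2 ^ k).-1 * gap_sum (2 ^ k) z ^+ (2 ^ m)) =
  num (odd k) z (z ^+ (2 ^ k)).
Proof.
move=> hz; have hzq : z * z ^+ (2 ^ m) = 1 by rewrite -exprS.
rewrite -(den_frob m) // -gap_sum_expn2 // exprMn !frobD expr1n -!exprM.
rewrite (mulnC 2) exprM.
have -> : z ^+ (2 ^ k) = z * z ^+ (2 ^ k).-1 by rewrite -exprS prednK ?expn_gt0.
by ring: hzq.
Qed.

(** If [den] vanished, so would its conjugate [num], and with them the nonzero monomials of
    [num_den_factor]. *)
Lemma den_neq0 (m k : nat) (z : F) : ~~ odd m ->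
  z ^+ (2 ^ m).+1 = 1 -> den (odd k) z (z ^+ (2 ^ k)) != 0.
Proof.
move=> hm hz; apply/eqP => d0.
have n0 := den_frob m k z hz; rewrite d0 expr0n expn_eq0 /= mulr0 in n0.
have [a0 b0] := addw_neq0 z (unit_circle_not_cube m z hm hz).
have /= := num_den_factor k z; case: (odd k) d0 n0 => -> <-; rewrite mulr0 addr0.
  by case=> /esym/eqP; rewrite mulf_eq0 expf_eq0 (negPf a0) (negPf b0) andbF.
case=> /esym/eqP; rewrite !mulf_eq0 !expf_eq0 (negPf a0) (negPf b0) !andbF.
by rewrite (negPf w_neq0).
Qed.

Lemma num_den_inj (m k : nat) (z y : F) : (0 < m)%N -> ~~ odd m ->
  (0 < k)%N -> (logn 2 k <= logn 2 m)%N ->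
  z ^+ (2 ^ m).+1 = 1 -> y ^+ (2 ^ m).+1 = 1 ->
  num (odd k) z (z ^+ (2 ^ k)) * den (odd k) y (y ^+ (2 ^ k)) =
  num (odd k) y (y ^+ (2 ^ k)) * den (odd k) z (z ^+ (2 ^ k)) -> z = y.
Proof.
move=> hm0 hm hk hv hz hy hnd.
have [bz az] := addw_neq0 z (unit_circle_not_cube m z hm hz).
have [bY aY] := addw_neq0 y (unit_circle_not_cube m y hm hy).
(* Cleared form of [(p / s) ^ (K - 1) = 1], where [p / s] is the quotient of the values of [a / b]
   at [z] and at [y]. *)
have hprod : ((z + w + 1) * (y + w)) ^+ (2 ^ k) * ((z + w) * (y + w + 1)) =
             ((z + w) * (y + w + 1)) ^+ (2 ^ k) * ((z + w + 1) * (y + w)).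
  (* Equal fractions stay equal under the Moebius map sending [t] to [(t + w) / (t + w ^ 2)]. *)
  have cross (N D N' D' : F) : N * D' = N' * D ->
    (N + w * D) * (N' + w ^+ 2 * D') = (N' + w * D') * (N + w ^+ 2 * D).
    by move=> h; ring: h.
  have := cross _ _ _ _ hnd; rewrite !exprMn.
  have /= := (num_den_factor k z, num_den_factor k y).
  move: (z + w) (z + w + 1) (y + w) (y + w + 1) => b a b' a'.
  case: (odd k) => -[[-> ->] [-> ->]] h; first by ring: h.
  by apply: (mulfI (expf_neq0 3 w_neq0)); ring: h.
set p := (z + w + 1) * (y + w) in hprod *.
set s := (z + w) * (y + w + 1) in hprod *.
have p0 : p != 0 by rewrite mulf_neq0.
have s0 : s != 0 by rewrite mulf_neq0.
(* As [w ^ q = w], here [x * a ^ q = w ^ 2 * b] and [x * b ^ q = w * a]. The factor [w] is the same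
   at [z] and [y], so it cancels in [p / s]. *)
have circ x : x ^+ (2 ^ m).+1 = 1 ->
  (x + w + 1) ^+ (2 ^ m).+1 = w * (x + w) ^+ (2 ^ m).+1.
  move=> hx; apply: (mulfI (unit_circle_neq0 m x hx)).
  have hxq : x * x ^+ (2 ^ m) = 1 by rewrite -exprS.
  rewrite !exprS !frobD expr1n expn2_w (negPf hm).
  by apply: (eq_mod2 _ x) => //; ring: hw hxq.
have : p / s = 1.
  apply: (expn2_roots_eq1 m k) => //; rewrite expr_div_n.
    apply: (canLR (mulfK _)); rewrite ?mul1r ?expf_neq0 //.
    apply: (mulIf (mulf_neq0 p0 s0)).
    have e x : x ^+ (2 ^ k) = x * x ^+ (2 ^ k).-1.
      by rewrite -exprS prednK ?expn_gt0.
    by move: hprod; rewrite !e => h; ring: h.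
  apply: (canLR (mulfK _)); rewrite ?mul1r ?expf_neq0 //.
  by rewrite /p /s !exprMn !circ //; ring.
move/(canRL (mulfVK s0)); rewrite mul1r => ps.
have : p - s = y - z by rewrite /p /s; ring.
by rewrite ps subrr => /esym/eqP; rewrite subr_eq0 => /eqP.
Qed.

End Char2.

(** * Existence of [w], and integer exponents *)

Lemma cube_root_exists (F : finFieldType) : 2 = 0 :> F ->
  (3 %| #|F|.-1)%N -> exists w : F, w ^+ 2 = w + 1.
Proof.
move=> h2; rewrite -card_finField_unit => /(Cauchy (isT : prime 3))[v _ ov].
exists (val v).
have v3 : val v ^+ 3 = 1 by rewrite -FinRing.val_unitX -ov expg_order.
have v1 : val v - 1 != 0.
  rewrite subr_eq0; apply/eqP => v1.
  have /eqP : v = 1%g by apply: val_inj.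
  by rewrite -order_eq1 ov.
(* Cancelling [v - 1] from [v ^ 3 - 1 = 0] leaves [v ^ 2 + v + 1 = 0]. *)
apply: (mulfI v1); apply: (eq_mod2 _ (1 - val v ^+ 2)) => //; ring: v3.
Qed.

Lemma exprz_eq1_coprime (F : fieldType) (x : F) (a b : int) : x != 0 ->
  coprimez a b -> x ^ a = 1 -> x ^ b = 1 -> x = 1.
Proof.
move=> x0 /coprimezP[[s t] /= e] ha hb.
by rewrite -[x]expr1z -e expfzDr // mulrC ![_ * a]mulrC ![_ * b]mulrC
  -!exprz_exp ha hb !exp1rz mulr1.
Qed.

Lemma expr_rexp (F : fieldType) (x : F) (m : nat) (d : int) : (0 < m)%N ->
  x ^+ (2 ^ (2 * m)).-1 = 1 -> x ^+ rexp m d = x ^ d.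
Proof.
move=> hm hx.
have hN : (1 < 2 ^ (2 * m))%N by rewrite -{1}(expn0 2) ltn_exp2l // muln_gt0.
have eN : (2 ^ (2 * m))%N%:Z - 1 = (2 ^ (2 * m)).-1%:Z by lia.
have x0 : x != 0.
  apply/eqP => x0; move/eqP: hx.
  by rewrite x0 expr0n -subn1 subn_eq0 leqNgt hN eq_sym oner_eq0.
rewrite [in RHS](divz_eq d ((2 ^ (2 * m))%N%:Z - 1)) expfzDr // mulrC.
rewrite [(_ %/ _)%Z * _]mulrC.
rewrite -exprz_exp {2}eN -[x ^ _.-1%:Z]/(x ^+ _) hx exp1rz mulr1 /rexp.
by rewrite -[in RHS](gez0_abs (modz_ge0 _ _)) // eN; lia.
Qed.

(** * Recovering [x] from [f x] *)

Theorem theorem6 (F : finFieldType) (m k i : nat) (u : int)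
    (hm0 : (0 < m)%N) (hm : ~~ odd m) (hk : (0 < k)%N) (hi : (0 < i)%N)
    (hF : #|F| = (2 ^ (2 * m))%N)
    (hv : (logn 2 k <= logn 2 m)%N)
    (hiQ : coprime i (Qm m))
    (hd1 : coprimez (dexp m k i u 1) ((2 ^ (2 * m))%N%:Z - 1))
    (hcase : ~~ odd k \/ (odd k /\ coprime (2 ^ k + 1) (Qm m))) :
  perm_poly (dpoly F m k i u).
Proof.
have h2 : 2 = 0 :> F.
  by have := card_finPcharP hF isT; rewrite inE => /andP[_ /eqP].
have q_ge4 : (4 <= 2 ^ m)%N by rewrite (@leq_exp2l 2 2) //; case: (m) hm0 hm => [|[]].
have qq : (2 ^ (2 * m) = 2 ^ m * 2 ^ m)%N by rewrite mul2n -addnn expnD.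
have [w hw] : exists w : F, w ^+ 2 = w + 1.
  apply: cube_root_exists => //; rewrite hF; have := expn2_mod3 (2 * m).
  by rewrite mul2n odd_double; lia.
set N := (2 ^ (2 * m)).-1.
have eN : (2 ^ (2 * m))%N%:Z - 1 = N%:Z by rewrite /N; lia.
have eNq : N%:Z = ((2 ^ m)%N%:Z - 1) * ((2 ^ m)%N%:Z + 1).
  by rewrite -eN qq PoszM; ring.
have xN (x : F) : x != 0 -> x ^+ N = 1.
  move=> x0; apply: (mulfI x0); rewrite -exprS mulr1 prednK ?expn_gt0 //.
  by rewrite -hF expf_card.
rewrite eN in hd1.
set f := fun x : F => (dpoly F m k i u).[x].
pose zz x : F := x ^ (((2 ^ m)%N%:Z - 1) * i%:Z).
have fE x : x != 0 -> f x = x ^ dexp m k i u 1 * gap_sum (2 ^ k) (zz x).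
  move=> x0; rewrite /f /dpoly horner_sum /gap_sum mulr_sumr.
  rewrite [LHS]big_nat_cond [RHS]big_nat_cond.
  apply: eq_bigr => j /andP[/andP[j0 _] _].
  rewrite hornerXn expr_rexp ?xN // /zz -[_ ^+ j.-1]/(_ ^ j.-1%:Z).
  rewrite exprz_exp -expfzDr //.
  congr (_ ^ _); rewrite /dexp /Qm.
  have -> : j.-1%:Z = j%:Z - 1 by lia.
  rewrite PoszD; ring.
have f0 : f 0 = 0.
  rewrite /f /dpoly horner_sum big1 // => j _.
  rewrite hornerXn expr0n; case: eqP => // /eqP.
  rewrite /rexp eN absz_eq0 => /eqP h.
  (* All [d_j] agree modulo [q - 1], so a zero reduced exponent would make [q - 1 >= 3] divide both
     [d_1] and [N]. *)
  have hqd : (((2 ^ m)%N%:Z - 1) %| dexp m k i u 1)%Z.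
    have -> : dexp m k i u 1 =
        dexp m k i u j - ((2 ^ m)%N%:Z - 1) * ((j%:Z - 1) * i%:Z).
      by rewrite /dexp /Qm PoszD; ring.
    rewrite rpredB ?dvdz_mulr // (@dvdz_trans N%:Z) //; last by apply/dvdz_mod0P.
    by rewrite eNq dvdz_mulr.
  have : (((2 ^ m)%N%:Z - 1) %| gcdz (dexp m k i u 1) N)%Z.
    by rewrite dvdz_gcd hqd eNq dvdz_mulr.
  by rewrite (eqP hd1) dvdz1; lia.
have zz_circle x : x != 0 -> zz x ^+ (2 ^ m).+1 = 1.
  move=> x0; rewrite -[_ ^+ _]/(_ ^ _.+1%:Z) /zz exprz_exp.
  have -> : ((2 ^ m)%N%:Z - 1) * i%:Z * (2 ^ m).+1%:Z = N%:Z * i%:Z.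
    by rewrite eNq; lia.
  by rewrite -exprz_exp -[x ^ N%:Z]/(x ^+ N) xN // exp1rz.
have f_neq0 x : x != 0 -> f x != 0.
  move=> x0; rewrite fE // mulf_neq0 ?expfz_neq0 //.
  apply/eqP => s0; have := den_neq0 F h2 w hw m k (zz x) hm (zz_circle x x0).
  by rewrite -gap_sum_expn2 // s0 mulr0 eqxx.
have f_frob x (z := zz x) : x != 0 ->
    den (odd k) z (z ^+ (2 ^ k)) * f x ^+ (2 ^ m) =
    num (odd k) z (z ^+ (2 ^ k)) * f x.
  move=> x0; have zc := zz_circle x x0.
  have hx : (x ^ dexp m k i u 1) ^+ (2 ^ m) = x ^ dexp m k i u 1 * z ^+ (2 ^ k).-1.
    rewrite -[_ ^+ (2 ^ m)]/(_ ^ (2 ^ m)%N%:Z) -[z ^+ _]/(z ^ _.-1%:Z) /z /zz.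
    rewrite !exprz_exp -expfzDr //.
    (* [d_1 * (q - 1)] is [(q - 1) * i * (K - 1)] plus [u] times [N = (q - 1) * (q + 1)]. *)
    have -> : dexp m k i u 1 * (2 ^ m)%N%:Z =
       dexp m k i u 1 + ((2 ^ m)%N%:Z - 1) * i%:Z * (2 ^ k).-1%:Z + N%:Z * u.
      have -> : (2 ^ k).-1%:Z = (2 ^ k)%N%:Z - 1 by have := expn_gt0 2 k; lia.
      by rewrite eNq /dexp /Qm PoszD; ring.
    rewrite [LHS]expfzDr // -(exprz_exp x N) -[x ^ N%:Z]/(x ^+ N) xN //.
    by rewrite exp1rz mulr1.
  rewrite -(gap_sum_frob F h2 m) // -gap_sum_expn2 // fE // exprMn hx -/z.
  ring.
apply: injF_bij => x y.
have [->|x0] := eqVneq x 0; have [->|y0] := eqVneq y 0 => //.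
- by rewrite -[_.[0]]/(f 0) f0 => /esym/eqP; rewrite (negPf (f_neq0 y y0)).
- by rewrite -[_.[0]]/(f 0) f0 => /eqP; rewrite (negPf (f_neq0 x x0)).
rewrite -![_.[_]]/(f _) => fxy.
have zxy : zz x = zz y.
  apply: (num_den_inj F h2 w hw m k) => //; try exact: zz_circle.
  (* The common value of [f] is nonzero, so the two instances of [f_frob] can be
     cross-multiplied. *)
  apply: (mulIf (mulf_neq0 (f_neq0 y y0) (expf_neq0 (2 ^ m) (f_neq0 y y0)))).
  have := f_frob x x0; have := f_frob y y0; rewrite fxy.
  move: (num _ _ _) (den _ _ _) (num _ _ _) (den _ _ _) => n d n' d' h h'.
  ring: h h'.
(* With equal [z] the sums cancel, leaving [(x / y) ^ d_1 = 1] with [d_1] prime to [N]. *)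
have : f x / f y = 1 by rewrite fxy mulfV ?f_neq0.
rewrite !fE // zxy.
have s0 : gap_sum (2 ^ k) (zz y) != 0.
  by have := f_neq0 y y0; rewrite fE // mulf_eq0 => /norP[].
rewrite -mulf_div mulfV // mulr1 invr_expz -exprz_inv -expfzMl => hd.
have xy0 : x / y != 0 by rewrite mulf_neq0 ?invr_eq0.
apply/divr1_eq/(exprz_eq1_coprime _ _ (dexp m k i u 1) N%:Z) => //.
exact: xN.
Qed.
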